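(* Let $n\ge3$, let $g:\overline{\mathbb{B}^n}\to\mathbb{R}^n$ be continuous, and let $M>0$. Then there is a constant $r_0>0$, depending only on $M$ and $g$, such that for every $f\in\mathcal{F}_g^M$, $$\mathbb{B}^n(0,r_0)\subset f(\mathbb{B}^n).$$
   Context: $\mathbb{B}^n$ is the open unit ball of $\mathbb{R}^n$ and $\mathbb{B}^n(0,r)$ the open ball of center $0$ and radius $r$. The Laplacian is taken componentwise, $J_f=\det D_f$ is the Jacobian determinant, $D_f=(\partial f_i/\partial x_j)$, and $\|h\|_\infty=\sup_{x\in\mathbb{B}^n}|h(x)|$ with $|\cdot|$ the Euclidean norm. $\mathcal{F}_g$ is the set of all mappings $f:\overline{\mathbb{B}^n}\to\mathbb{R}^n$ that are continuous on $\overline{\mathbb{B}^n}$, of class $\mathcal{C}^2$ in $\mathbb{B}^n$, and satisfy $\Delta f=g$ in $\mathbb{B}^n$ together with $f(0)=0$ and $J_f(0)=1$. $\mathcal{F}_g^M$ is the set of all $f\in\mathcal{F}_g$ satisfying $\|f\|_\infty+\|g\|_\infty\le M$. *)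

(* Defs.v *)
From HB Require Import structures.
From mathcomp Require Import all_boot all_order all_algebra.
From mathcomp Require Import all_classical all_reals all_analysis.
Import Order.TTheory GRing.Theory Num.Theory.
Import numFieldNormedType.Exports.

Set Implicit Arguments.
Unset Strict Implicit.
Unset Printing Implicit Defensive.

Local Open Scope classical_set_scope.
Local Open Scope ring_scope.

(* Vectors of R^n are row vectors ['rV[R]_n].  Their library norm is the
   max norm, whose topology is the usual one; lengths and balls below are
   nevertheless taken for the Euclidean norm, hence [enorm]. *)
Section Euclidean.
Context {R : realType} {n : nat}.
Implicit Types (x : 'rV[R]_n) (r : R).

Definition enorm x : R := Num.sqrt (\sum_(i < n) x 0 i ^+ 2).

Definition eball r : set 'rV[R]_n := [set x | enorm x < r].

Definition ecball r : set 'rV[R]_n := [set x | enorm x <= r].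

(* Extended-real valued, so that it is +oo when [h] is unbounded. *)
Definition supnorm (h : 'rV[R]_n -> 'rV[R]_n) : \bar R :=
  ereal_sup [set (enorm (h x))%:E | x in eball 1].

End Euclidean.

Section Calculus.
Context {R : realType} {n : nat}.
Implicit Types (u : 'rV[R]_n -> R) (f : 'rV[R]_n -> 'rV[R]_n).
Implicit Types (U : set 'rV[R]_n) (x : 'rV[R]_n).

Definition partial (j : 'I_n) u : 'rV[R]_n -> R :=
  fun x => 'D_(delta_mx 0 j) u x.

Definition component f (i : 'I_n) : 'rV[R]_n -> R := fun x => f x 0 i.

(* [C1_on U] and [C2_on U] are meant for open [U]: derivability and continuity
   at the points of [U] are then insensitive to the values of [u] off [U]. *)
Definition C1_on U u : Prop :=
  forall (j : 'I_n) x, U x ->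
    derivable u x (delta_mx 0 j) /\ {for x, continuous (partial j u)}.

Definition C2_on U u : Prop :=
  C1_on U u /\ forall j : 'I_n, C1_on U (partial j u).

Definition laplacian u : 'rV[R]_n -> R :=
  fun x => \sum_(j < n) partial j (partial j u) x.

Definition vlaplacian f : 'rV[R]_n -> 'rV[R]_n :=
  fun x => \row_(i < n) laplacian (component f i) x.

(* Row [i], column [j] holds the [j]-th partial derivative of [f_i]; this is the
   transpose of the row-vector convention used by the library's [jacobian]. *)
Definition jacobian_mx f x : 'M[R]_n :=
  \matrix_(i < n, j < n) partial j (component f i) x.

Definition jacobian_det f x : R := \det (jacobian_mx f x).

End Calculus.

Section Classes.
Context {R : realType} {n : nat}.
Implicit Types f g : 'rV[R]_n -> 'rV[R]_n.

(* A map on the closed unit ball is represented by a total function whose values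
   off that ball are irrelevant: no clause below depends on them. *)
Definition Fclass g : set ('rV[R]_n -> 'rV[R]_n) :=
  [set f | [/\ {within ecball 1, continuous f},
               forall i : 'I_n, C2_on (eball 1) (component f i),
               forall x, eball 1 x -> vlaplacian f x = g x,
               f 0 = 0
             & jacobian_det f 0 = 1]].

Definition FclassM g (M : R) : set ('rV[R]_n -> 'rV[R]_n) :=
  [set f | Fclass g f /\ (supnorm f + supnorm g <= M%:E)%E].

End Classes.

(* Main.v *)
From HB Require Import structures.
Require Import Defs.
From mathcomp Require Import all_boot all_order all_algebra.
From mathcomp Require Import all_classical all_reals all_analysis.
From mathcomp Require Import perm.
From mathcomp Require Import ring lra.
Import Order.TTheory GRing.Theory Num.Theory.
Import numFieldNormedType.Exports.
Set Implicit Arguments.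
Unset Strict Implicit.
Unset Printing Implicit Defensive.
Local Open Scope classical_set_scope.
Local Open Scope ring_scope.

(** The point is that the class differs from a single one of its members by
    harmonic maps. If the class is empty there is nothing to prove; otherwise
    fix [f0] in it. For any other member [f], every component of [f - f0] is
    harmonic and bounded by [2 * M], because both maps have the same Laplacian.
    Interior estimates for bounded harmonic functions then bound the gradient
    of [f - f0] at the origin and give it a Lipschitz constant near the origin,
    both in terms of [M] and the dimension. Adding the modulus of continuity of
    the gradient of the one map [f0], all members of the class have a common
    bound on their Jacobian matrix at [0] and a common modulus of continuity of
    their gradient at [0]. Since the Jacobian determinant at [0] is [1], the
    inverse of that matrix is its adjugate, which is therefore bounded too, and
    the usual contraction argument for the inverse function theorem yields a
    radius valid for the whole class.

    The harmonic estimates need only the maximum principle, in the form of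
    Brandt's comparison argument. For [u] harmonic on a cube of radius [d] the
    function [u (a + x) - u (a + reflect_coord j x)], odd in [x_j], vanishes where
    [x_j = 0], so on the half cube it is dominated by an explicit
    superharmonic [barrier]; this bounds the symmetric difference
    [u (a + t e_j) - u (a - t e_j)] by a multiple of [t]
    ([harmonic_symdiff]). A symmetric difference of [u] is again harmonic, so
    applying the same bound to it controls second differences
    ([harmonic_second_symdiff]); dividing by one step gives the Lipschitz bound
    on the partial derivatives without any third derivative
    ([harmonic_partial_lipschitz]).

    Estimates are made in cubes, that is in the max norm, which suits the
    half-cube comparison and moving along one coordinate at a time. *)

(** * Second derivatives along a line *)

Section SecondDerivative.
Context {R : realType}.
Implicit Types F G : R -> R.

(** The first derivative [F'] is carried as a witness near [0], so that the
    notion passes directly to differences and to [s |-> F (c * s)]. *)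
Definition has_deriv2 F (l : R) : Prop :=
  exists F' : R -> R,
    (\forall s \near (0 : R), is_derive (s : R) (1 : R) F (F' s)) /\
    is_derive (0 : R) (1 : R) F' l.

Lemma has_deriv2B F G l m : has_deriv2 F l -> has_deriv2 G m ->
  has_deriv2 (fun s => F s - G s) (l - m).
Proof.
move=> [F' [dF dF']] [G' [dG dG']]; exists (fun s => F' s - G' s); split.
  near=> s.
  have ? : is_derive s (1 : R) F (F' s) by near: s.
  have ? : is_derive s (1 : R) G (G' s) by near: s.
  exact: is_deriveB.
exact: is_deriveB.
Unshelve. all: by end_near. Qed.

Lemma has_deriv2_comp_mul F l (c : R) : has_deriv2 F l ->
  has_deriv2 (fun s => F (c * s)) (c ^+ 2 * l).
Proof.
move=> [F' [dF dF']].
have dm (s : R) : is_derive s (1 : R) ( *%R c) c.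
  rewrite -[X in is_derive _ _ _ X]mulr1.
  exact: (@is_deriveZ _ _ _ id c s 1 1).
have comp (H : R -> R) (s h : R) : is_derive (c * s) (1 : R) H h ->
    is_derive s (1 : R) (fun s => H (c * s)) (c * h).
  by move=> dH; rewrite [c * h]mulrC; exact: (@is_derive1_comp _ H ( *%R c)).
exists (fun s => c * F' (c * s)); split.
  have cs : (c * s) @[s --> (0 : R)] --> (0 : R).
    rewrite -[X in _ --> X](mulr0 c).
    exact: mulrl_continuous.
  near=> s; apply: comp; near: s; exact: (cs _ dF).
rewrite expr2 -mulrA.
apply: (@is_deriveZ _ _ _ (fun s => F' (c * s)) c).
by apply: comp; rewrite mulr0.
Unshelve. all: by end_near. Qed.

Lemma has_deriv2_quad (p q r : R) :
  has_deriv2 (fun s => p + q * s + r * s ^+ 2) (2 * r).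
Proof.
exists (fun s => q + 2 * r * s); split.
  near=> s.
  apply: is_derive_eq; rewrite /GRing.scale /=; ring.
apply: is_derive_eq; rewrite /GRing.scale /=; ring.
Unshelve. all: by end_near. Qed.

(** With [F' 0 = 0] and a positive second derivative, [F'] would be positive just
    to the right of [0] and [F] would increase there. *)
Lemma has_deriv2_max F l : has_deriv2 F l ->
  (\forall s \near (0 : R), F s <= F 0) -> l <= 0.
Proof.
move=> [F' [dF dF']] mF; rewrite leNgt; apply/negP => l0.
have [e /= e0 He] : exists2 e : R, 0 < e & forall s, `|s| < e ->
    is_derive s (1 : R) F (F' s) /\ F s <= F 0.
  have [e /= e0 He] := (filterI dF mF).
  by exists e => //= s se; apply: He; rewrite /= sub0r normrN.
have F'0 : F' 0 = 0.
  have := @derive1_at_max _ F (- e) e 0.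
  have d0 : is_derive (0 : R) (1 : R) F (F' 0) by apply: (He 0 _).1; rewrite normr0.
  move=> H; rewrite -(@derive_val _ _ _ _ _ _ _ d0).
  suff h : is_derive (0 : R) (1 : R) F 0 by rewrite (@derive_val _ _ _ _ _ _ _ h).
  apply: H.
  - lra.
  - by move=> t; rewrite in_itv/= -ltr_norml => /He[[? _] _].
  - by rewrite in_itv/= oppr_lt0 e0.
  - by move=> t; rewrite in_itv/= -ltr_norml => /He [].
have [t [t0 te F'p]] : exists t : R, [/\ 0 < t, t < e &
    forall s, 0 < s -> s <= t -> 0 < F' s].
  have [+ dv] := dF'.
  move=> cv; have cl : h^-1 *: ((F' \o shift 0) (h *: 1) - F' 0) @[h --> 0^'] --> l.
    by rewrite -dv; exact: cv.
  have := @cvgr_gt _ _ _ _ _ _ cl 0 l0.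
  case=> r /= r0 Hr.
  exists (Num.min (r / 2) (e / 2)).
  have m1 : Num.min (r/2) (e/2) <= r / 2 by rewrite ge_min lexx.
  have m2 : Num.min (r/2) (e/2) <= e / 2 by rewrite ge_min lexx orbT.
  split.
  - rewrite lt_min; apply/andP; split; lra.
  - lra.
  move=> s s0 st; have := Hr s; rewrite /= sub0r normrN gtr0_norm //.
  have -> : s < r by lra.
  move=> /(_ isT (lt0r_neq0 s0)); rewrite F'0 subr0 addr0 /GRing.scale /= mulr1.
  by rewrite pmulr_rgt0 ?invr_gt0.
have [] := @MVT _ F F' 0 t t0.
- move=> x; rewrite in_itv/= => /andP[x0 xt]; apply: (He _ _).1.
  by rewrite gtr0_norm //; lra.
- apply: derivable_within_continuous => x; rewrite in_itv/= => /andP[x0 xt].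
  by have [[]] : is_derive x (1 : R) F (F' x) /\ F x <= F 0
    by apply: He; rewrite ger0_norm //; lra.
move=> c; rewrite in_itv/= => /andP[c0 ct] eqF.
have : F t <= F 0 by apply: (He _ _).2; rewrite gtr0_norm.
have : 0 < F' c * (t - 0) by rewrite subr0 mulr_gt0 // F'p // ltW.
lra.
Qed.

End SecondDerivative.

(** * Harmonic functions and the comparison argument *)

Section Harmonic.
Context {R : realType} {n : nat}.
Local Notation V := 'rV[R]_n.
Local Notation e_ j := (delta_mx (0 : 'I_1) (j : 'I_n) : V).
Implicit Types (u v : V -> R) (x y a : V).

Lemma rV_norm_leP x (d : R) : 0 <= d ->
  (`|x| <= d) <-> (forall i, `|x 0 i| <= d).
Proof.
move=> d0; change `|x| with (mx_norm x); rewrite mx_normrE; split.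
  by move=> /bigmax_leP[_ H] i; exact: (H (0, i)).
by move=> H; apply/bigmax_leP; split=> // -[i j] _ /=; rewrite ord1.
Qed.

Lemma rV_coord_le x i : `|x 0 i| <= `|x|.
Proof. by move: i; apply/rV_norm_leP. Qed.

Lemma norm_delta_le j : `|e_ j| <= 1.
Proof.
apply/rV_norm_leP => // i; rewrite mxE /= .
by case: (i == j); rewrite /= ?normr1 ?normr0.
Qed.

Lemma norm_scale_delta (t : R) j : `|t *: e_ j| <= `|t|.
Proof. by rewrite normrZ ler_piMr // norm_delta_le. Qed.

(** This asks only for what the maximum principle uses, continuity and pure second
    derivatives with zero sum, and is therefore stable under reflections and
    differences without any regularity argument. *)
Definition harmonic_at u x : Prop :=
  {for x, continuous u} /\
  exists c : 'I_n -> R,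
    (forall i, has_deriv2 (fun s => u (x + s *: e_ i)) (c i)) /\
    \sum_i c i = 0.

Lemma harmonic_atB u v x : harmonic_at u x -> harmonic_at v x ->
  harmonic_at (fun y => u y - v y) x.
Proof.
move=> [cu [c [Hc c0]]] [cv [d [Hd d0]]]; split.
  exact: continuousB.
exists (fun i => c i - d i); split; last by rewrite sumrB c0 d0 subrr.
by move=> i; exact: has_deriv2B.
Qed.

(** Each [c i] is a sign: the coordinate lines are only reversed, and second
    derivatives do not see a reversal. *)
Lemma harmonic_at_comp u (L : V -> V) (c : 'I_n -> R) x :
  {for x, continuous L} ->
  (forall i, c i ^+ 2 = 1) ->
  (forall i s, L (x + s *: e_ i) = L x + (c i * s) *: e_ i) ->
  harmonic_at u (L x) -> harmonic_at (u \o L) x.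
Proof.
move=> cL c2 HL [cu [l [Hl l0]]]; split.
  exact: continuous_comp.
exists l; split=> // i.
have := has_deriv2_comp_mul (c i) (Hl i); rewrite c2 mul1r.
by congr has_deriv2; apply/funext => s /=; rewrite HL.
Qed.

Lemma harmonic_at_shift u a x : harmonic_at u (a + x) ->
  harmonic_at (fun y => u (a + y)) x.
Proof.
move=> H; apply: (@harmonic_at_comp u (fun y => a + y) (fun=> 1)) => //.
- by apply: continuousD; [exact: cst_continuous|exact: cvg_id].
- by move=> i; rewrite expr1n.
- by move=> i s; rewrite mul1r addrA.
Qed.

Definition reflect_coord (j : 'I_n) x : V := x - (2 * x 0 j) *: e_ j.

Lemma reflect_coordE j x i :
  reflect_coord j x 0 i = if i == j then - x 0 j else x 0 i.
Proof.
rewrite !mxE /=; case: eqP => [->|_] /=; last by rewrite mulr0 subr0.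
by rewrite mulr1; ring.
Qed.

Lemma harmonic_at_reflect u a j x : harmonic_at u (a + reflect_coord j x) ->
  harmonic_at (fun y => u (a + reflect_coord j y)) x.
Proof.
move=> H.
apply: (@harmonic_at_comp (fun y => u (a + y)) (reflect_coord j)
          (fun i => if i == j then -1 else 1)).
- apply: continuousB; first exact: cvg_id.
  apply: continuousZr_tmp.
  apply: continuousM; first exact: cst_continuous.
  exact: coord_continuous.
- by move=> i; case: ifP; rewrite ?sqrrN expr1n.
- move=> i s; apply/rowP => k; rewrite reflect_coordE [RHS]mxE reflect_coordE !mxE /=.
  case: (eqVneq i j) => [->|ij]; rewrite ?eqxx /=; first by case: (k == j); rewrite /=; ring.
  rewrite mul1r mulr0 addr0.
  by case: (eqVneq k j) => [->|//]; rewrite [j == i]eq_sym (negbTE ij) /=; ring.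
exact: harmonic_at_shift.
Qed.

(** For [0 < k], the coefficient [n.+1] makes the Laplacian equal to the negative
    number [2 * k * n - 2 * k * n.+1], while on the half cube [0 <= x_j <= d],
    [|x_i| <= d] the function stays nonnegative and is at least [k * d ^ 2] on
    every face other than [x_j = 0]. *)
Definition barrier (d k : R) (j : 'I_n) x : R :=
  k * (\sum_i x 0 i ^+ 2 + n.+1%:R * (x 0 j * (d - x 0 j))).

Lemma continuous_barrier d k j x : {for x, continuous (barrier d k j)}.
Proof.
have cc i : {for x, continuous (fun y : V => y 0 i)} by exact: coord_continuous.
apply: continuousM; first exact: cst_continuous.
apply: continuousD.
  apply: cvg_big; first exact: add_continuous.
    exact: (@nbhs_filter V x).
  move=> i _; rewrite expr2.
  by apply: (@continuousM _ _ (fun y : V => y 0 i) (fun y : V => y 0 i)).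
apply: continuousM; first exact: cst_continuous.
apply: continuousM; first exact: cc.
by apply: continuousB; [exact: cst_continuous|exact: cc].
Qed.

Lemma barrier_deriv2 d k j x i :
  has_deriv2 (fun s => barrier d k j (x + s *: e_ i))
    (2 * (k * (1 - n.+1%:R * (i == j)%:R))).
Proof.
have := @has_deriv2_quad R (barrier d k j x)
  (k * (2 * x 0 i + n.+1%:R * (i == j)%:R * (d - 2 * x 0 j)))
  (k * (1 - n.+1%:R * (i == j)%:R)).
congr has_deriv2; apply/funext => s; rewrite /barrier.
rewrite (bigD1 i) //= [in RHS](bigD1 i) //=.
have -> : \sum_(l < n | l != i) (x + s *: e_ i) 0 l ^+ 2 =
          \sum_(l < n | l != i) x 0 l ^+ 2.
  by apply: eq_bigr => l li; rewrite !mxE (negbTE li) andbF mulr0 addr0.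
rewrite !mxE !eqxx /= [j == i]eq_sym.
have [ij|_] := eqVneq i j; [rewrite -ij|];
  move: (\sum_(l < n | l != i) x 0 l ^+ 2) (x 0 j) (x 0 i) => S y z; rewrite /=; ring.
Qed.

Lemma sum_barrier_deriv2 (k : R) (j : 'I_n) :
  \sum_i (2 * (k * (1 - n.+1%:R * (i == j)%:R))) = - (2 * k).
Proof.
rewrite -mulr_sumr -mulr_sumr sumrB -mulr_sumr sumr_const card_ord.
rewrite (bigD1 j) //= eqxx big1 ?addr0; last by move=> i /negbTE ->.
by rewrite -natr1 mulr1; ring.
Qed.

(** The difference of [u] and its reflection, minus the barrier, has positive
    Laplacian, so its maximum on the half cube [B] is not interior; it is
    nonpositive on the boundary, hence everywhere, and [t e_j] lies in [B]. *)
Lemma harmonic_symdiff_le u a (d K : R) (j : 'I_n) (t : R) :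
  0 < d -> 0 < K -> 0 <= t -> t <= d ->
  (forall x, `|x| <= d -> harmonic_at u (a + x) /\ `|u (a + x)| <= K) ->
  u (a + t *: e_ j) - u (a - t *: e_ j) <= 2 * (n.+1%:R * K / d) * t.
Proof.
move=> d0 K0 t0 td Hu.
(* [u] and its reflection differ by at most [2 * K], which the barrier must reach
   where [|x_i| = d]. *)
pose k := 2 * K / d ^+ 2.
have k0 : 0 < k by rewrite /k divr_gt0 ?mulr_gt0 // exprn_gt0.
have kd : k * d ^+ 2 = 2 * K by rewrite /k divfK // expf_neq0 // gt_eqF.
pose W x := (u (a + x) - u (a + reflect_coord j x)) - barrier d k j x.
pose B : set V := [set x | forall i,
  (if i == j then `[0, d]%classic else `[(- d), d]%classic) (x ord0 i)].
have BP x : B x <-> `|x| <= d /\ 0 <= x 0 j.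
  split=> [Bx|[xd xj] i].
    split; last by have := Bx j; rewrite eqxx /= in_itv /= => /andP[].
    apply/rV_norm_leP; first exact: ltW.
    move=> i; have := Bx i; case: ifP => _; rewrite /= in_itv /=.
      by move=> /andP[? ?]; rewrite ger0_norm.
    by rewrite ler_norml.
  have := rV_coord_le x i => /le_trans/(_ xd).
  rewrite ler_norml => /andP[h1 h2].
  by case: eqP => [ij|_]; rewrite /= in_itv /= h2 ?h1 // ij xj.
have Bref x : B x -> `|reflect_coord j x| <= d.
  move=> /BP[xd xj]; apply/rV_norm_leP; first exact: ltW.
  move=> i; rewrite reflect_coordE; case: ifP => _; rewrite ?normrN;
  exact: le_trans (rV_coord_le _ _) xd.
have cB : compact B.
  apply: (@rV_compact R n
    (fun i => if i == j then `[0, d]%classic else `[(- d), d]%classic)).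
  by move=> i; case: ifP => _; exact: segment_compact.
have B0 : B 0 by apply/BP; rewrite normr0 mxE lexx ltW.
have harm x : B x -> harmonic_at (fun y => u (a + y) - u (a + reflect_coord j y)) x.
  move=> Bx; apply: harmonic_atB.
    by apply: harmonic_at_shift; apply: (Hu _ _).1; move/BP: Bx => [].
  by apply: harmonic_at_reflect; apply: (Hu _ _).1; exact: Bref.
have cW : {within B, continuous W}.
  apply: continuous_in_subspaceT => x; rewrite inE => Bx.
  exact: (continuousB (harm x Bx).1 (@continuous_barrier d k j x)).
have [p + maxp] := compact_EVT_max (ex_intro _ 0 B0 : B !=set0) cB cW.
rewrite inE => Bp.
have diff2K x : B x -> u (a + x) - u (a + reflect_coord j x) <= 2 * K.
  move=> Bx; have [_] := Hu _ (Bref _ Bx); have [_] := Hu x ((BP x).1 Bx).1.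
  by rewrite !ler_norml => /andP[? ?] /andP[? ?]; lra.
have [pd pj0] := (BP p).1 Bp.
have pj : p 0 j <= d.
  by apply: le_trans (ler_norm _) (le_trans (rV_coord_le _ _) pd).
have sq_ge0 : 0 <= \sum_i p 0 i ^+ 2 by apply: sumr_ge0 => i _; exact: sqr_ge0.
have bar_ge0 : 0 <= barrier d k j p.
  apply: mulr_ge0; first exact: ltW.
  by apply: addr_ge0 => //; rewrite !mulr_ge0 // subr_ge0.
have Wp : W p <= 0.
  have [/eqP p0|pjn0] := boolP (p 0 j == 0).
    rewrite /W; suff -> : reflect_coord j p = p by rewrite subrr sub0r oppr_le0.
    by rewrite /reflect_coord p0 mulr0 scale0r subr0.
  have {}pj0 : 0 < p 0 j by rewrite lt_def pjn0.
  have [[i pi]|Hin] := pselect (exists i, `|p 0 i| = d).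
    suff : 2 * K <= barrier d k j p by have := diff2K p Bp; rewrite /W; lra.
    rewrite -kd /barrier ler_pM2l //.
    rewrite (bigD1 i) //= -[p 0 i ^+ 2]real_normK ?num_real // pi -addrA lerDl.
    apply: addr_ge0; first by apply: sumr_ge0 => l _; exact: sqr_ge0.
    by rewrite !mulr_ge0 // ?subr_ge0 // ltW.
  have {}Hin i : `|p 0 i| < d.
    rewrite lt_neqAle (le_trans (rV_coord_le _ _) pd) andbT.
    by apply/eqP => pi; apply: Hin; exists i.
  (* An interior maximum: the second derivatives at [p] along the axes are
     nonpositive, but they add up to [2 * k]. *)
  exfalso.
  have [_ [c [Hc c0]]] := harm p Bp.
  have : \sum_i (c i - 2 * (k * (1 - n.+1%:R * (i == j)%:R))) <= 0.
    apply: sumr_le0 => i _.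
    apply: (has_deriv2_max (has_deriv2B (Hc i) (barrier_deriv2 d k j p i))).
    have [r r0 Hr] : exists2 r : R, 0 < r & forall s, `|s| < r -> B (p + s *: e_ i).
      exists (Num.min (d - `|p 0 i|) (p 0 j)).
        by rewrite lt_min subr_gt0 Hin pj0.
      move=> s; rewrite lt_min => /andP[s1 s2].
      apply/BP; split.
        apply/rV_norm_leP; first exact: ltW.
        move=> l; rewrite !mxE /=; case: (eqVneq l i) => [->|li] /=.
          by rewrite mulr1 (le_trans (ler_normD _ _)) //; lra.
        by rewrite mulr0 addr0 ltW.
      rewrite !mxE /=; case: (j == i); rewrite ?mulr0 ?addr0 ?mulr1 ?ltW //.
      by move: s2; rewrite ltr_norml => /andP[]; lra.
    exists r => // s; rewrite /= sub0r normrN => sr.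
    have := maxp (p + s *: e_ i); rewrite inE => /(_ (Hr _ sr)).
    by rewrite /W scale0r addr0.
  rewrite sumrB c0 sum_barrier_deriv2; lra.
have Bt : B (t *: e_ j).
  apply/BP; split; last by rewrite !mxE !eqxx mulr1.
  by rewrite (le_trans (norm_scale_delta _ _)) // ger0_norm.
have : W (t *: e_ j) <= 0.
  by apply: le_trans Wp; apply: maxp; rewrite inE.
have -> : W (t *: e_ j) = (u (a + t *: e_ j) - u (a - t *: e_ j))
      - k * (t ^+ 2 + n.+1%:R * (t * (d - t))).
  rewrite /W; congr (_ - u (a + _) - _).
    apply/rowP => i; rewrite reflect_coordE !mxE !eqxx /=.
    by case: (i == j); rewrite /= ?mulr0 ?oppr0.
  rewrite /barrier !mxE !eqxx mulr1 (bigD1 j) //= big1 ?addr0.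
    by rewrite !mxE !eqxx mulr1.
  by move=> i ij; rewrite !mxE (negbTE ij) andbF mulr0 expr0n.
have -> : 2 * (n.+1%:R * K / d) * t = k * (n.+1%:R * (t * d)).
  by rewrite /k; field; rewrite gt_eqF.
suff : k * (t ^+ 2 + n.+1%:R * (t * (d - t))) <= k * (n.+1%:R * (t * d)) by lra.
rewrite ler_pM2l // -natr1; have : 0 <= n%:R * t ^+ 2 :> R.
  by rewrite mulr_ge0 // sqr_ge0.
nra.
Qed.

Lemma harmonic_atN u x : harmonic_at u x -> harmonic_at (fun y => - u y) x.
Proof.
move=> hu; have -> : (fun y => - u y) = (fun y => (u y - u y) - u y).
  by apply/funext => y; rewrite subrr sub0r.
by do 2!apply: harmonic_atB => //.
Qed.

Lemma harmonic_symdiff u a (d K : R) (j : 'I_n) (t : R) :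
  0 < d -> 0 < K -> 0 <= t -> t <= d ->
  (forall x, `|x| <= d -> harmonic_at u (a + x) /\ `|u (a + x)| <= K) ->
  `|u (a + t *: e_ j) - u (a - t *: e_ j)| <= 2 * (n.+1%:R * K / d) * t.
Proof.
move=> d0 K0 t0 td Hu; rewrite ler_norml; apply/andP; split; last first.
  exact: harmonic_symdiff_le.
have := @harmonic_symdiff_le (fun y => - u y) a d K j t d0 K0 t0 td.
rewrite lerNl => H; rewrite opprB addrC -[X in _ + X]opprK opprK.
rewrite -[X in X - _]opprK; apply: le_trans (H _).
  by rewrite opprK; lra.
by move=> x /Hu[? ?]; split; [exact: harmonic_atN|rewrite normrN].
Qed.

(** The inner symmetric difference, in direction [j], is itself harmonic and has
    size of order [t], so [harmonic_symdiff] applies to it in direction [i]. The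
    factor [3] leaves room for [b] and for one step of each kind. *)
Lemma harmonic_second_symdiff u (d K : R) (i j : 'I_n) (b : V) (s t : R) :
  0 < d -> 0 < K -> 0 <= t -> t <= d -> 0 <= s -> s <= d -> `|b| <= d ->
  (forall x, `|x| <= 3 * d -> harmonic_at u x /\ `|u x| <= K) ->
  `|(u (b + s *: e_ i + t *: e_ j) - u (b + s *: e_ i - t *: e_ j)) -
    (u (b - s *: e_ i + t *: e_ j) - u (b - s *: e_ i - t *: e_ j))| <=
  (2 * (n.+1%:R / d)) ^+ 2 * K * s * t.
Proof.
move=> d0 K0 t0 td s0 sd bd Hu.
have [<-|tn0] := eqVneq 0 t.
  by rewrite scale0r !addr0 !subr0 !subrr normr0 mulr0.
have {}t0 : 0 < t by rewrite lt_neqAle tn0.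
pose K' := 2 * (n.+1%:R * K / d) * t.
have K'0 : 0 < K' by rewrite !mulr_gt0 // invr_gt0.
have := @harmonic_symdiff (fun y => u (y + t *: e_ j) - u (y - t *: e_ j)) b d K' i s d0 K'0 s0 sd.
have -> : 2 * (n.+1%:R * K' / d) * s = (2 * (n.+1%:R / d)) ^+ 2 * K * s * t.
  by rewrite /K'; field; rewrite gt_eqF.
apply=> x xd.
have bxd : `|b + x| <= 2 * d by rewrite (le_trans (ler_normD _ _)) //; lra.
split.
  have nt : `|t *: e_ j| <= d.
    by rewrite (le_trans (norm_scale_delta _ _)) // ger0_norm // ltW.
  have -> : (fun y => u (y + t *: e_ j) - u (y - t *: e_ j)) =
      (fun y => u (t *: e_ j + y) - u (- (t *: e_ j) + y)).
    by apply/funext => y; congr (u _ - u _); exact: addrC.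
  by apply: harmonic_atB; apply: harmonic_at_shift; apply: (Hu _ _).1;
    rewrite (le_trans (ler_normD _ _)) // ?normrN; lra.
apply: harmonic_symdiff => //; first exact: ltW.
move=> y yd; apply: Hu; rewrite (le_trans (ler_normD _ _)) //; lra.
Qed.

End Harmonic.

(** * Gradient estimates *)

Section PartialDerivatives.
Context {R : realType} {n : nat}.
Local Notation V := 'rV[R]_n.
Local Notation e_ j := (delta_mx (0 : 'I_1) (j : 'I_n) : V).
Implicit Types (u v : V -> R) (x y z b : V).

Lemma is_derive_line u x j (s : R) : derivable u (x + s *: e_ j) (e_ j) ->
  is_derive s (1 : R) (fun s => u (x + s *: e_ j)) (partial j u (x + s *: e_ j)).
Proof.
have E : (fun h : R => h^-1 *: (((fun s => u (x + s *: e_ j)) \o shift s) (h *: 1) -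
    u (x + s *: e_ j))) =
  (fun h => h^-1 *: ((u \o shift (x + s *: e_ j)) (h *: e_ j) - u (x + s *: e_ j))).
  apply/funext => h /=; congr (_ *: (u _ - _)).
  by rewrite [_ *: 1]mulr1 scalerDl addrCA.
move=> du; apply: DeriveDef; first by rewrite /derivable E.
by rewrite /partial /derive E.
Qed.

Lemma C2_on_has_deriv2 (U : set V) u x j : open U -> U x -> C2_on U u ->
  has_deriv2 (fun s => u (x + s *: e_ j)) (partial j (partial j u) x).
Proof.
move=> oU Ux [C1 C2]; exists (fun s => partial j u (x + s *: e_ j)).
have xU : \forall s \near (0 : R), U (x + s *: e_ j).
  have cl : (x + s *: e_ j) @[s --> (0 : R)] --> x.
    have : {for 0, continuous (fun s : R => x + s *: e_ j)}.
      by apply: continuousD; [exact: cst_continuous|exact: scalel_continuous].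
    by rewrite /prop_for /continuous_at /= scale0r addr0.
  by apply: cl; exact: open_nbhs_nbhs.
split.
  near=> s; apply: is_derive_line; apply: (C1 j _ _).1.
  by near: s.
have := @is_derive_line (partial j u) x j 0; rewrite scale0r addr0; apply.
exact: (C2 j j x Ux).1.
Unshelve. all: by end_near. Qed.

Lemma harmonic_at_sub (U : set V) u v x : open U -> U x ->
  C2_on U u -> C2_on U v -> {for x, continuous u} -> {for x, continuous v} ->
  laplacian u x = laplacian v x -> harmonic_at (fun y => u y - v y) x.
Proof.
move=> oU Ux Cu Cv cu cv uv; split; first exact: continuousB.
exists (fun i => partial i (partial i u) x - partial i (partial i v) x).
split; last by rewrite sumrB; apply/eqP; rewrite subr_eq0; apply/eqP.
by move=> i; apply: has_deriv2B; exact: (C2_on_has_deriv2 _ oU).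
Qed.

Lemma is_derive_bound (F : R -> R) (l L d : R) : 0 < d ->
  is_derive (0 : R) (1 : R) F l -> F 0 = 0 ->
  (forall s, 0 < s -> s <= d -> `|F s| <= L * s) -> `|l| <= L.
Proof.
move=> d0 [+ dv] F0 HF => cv.
have cl : h^-1 *: ((F \o shift 0) (h *: 1) - F 0) @[h --> 0^'] --> l.
  by rewrite -dv; exact: cv.
have {}cl : h^-1 *: ((F \o shift 0) (h *: 1) - F 0) @[h --> 0^'+] --> l.
  move: cl; apply: cvg_trans; apply: cvg_app.
  by move=> A [e egt0 Ae]; exists e => // y ye y0; apply: Ae => //; exact: lt0r_neq0.
apply: (cvgr_to_le (cvg_norm cl)).
near=> h.
have h0 : 0 < h by [].
rewrite /= F0 subr0 addr0 [_ *: 1]mulr1 normrZ gtr0_norm ?invr_gt0 //.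
rewrite ler_pdivrMl // mulrC; apply: HF => //.
by near: h; exact: nbhs_right_le.
Unshelve. all: by end_near. Qed.

Lemma is_derive_symdiff u x j : derivable u x (e_ j) ->
  is_derive (0 : R) (1 : R)
    (fun s => u (x + s *: e_ j) - u (x - s *: e_ j)) (2 * partial j u x).
Proof.
move=> du.
have d1 : is_derive (0 : R) (1 : R) (fun s => u (x + s *: e_ j)) (partial j u x).
  by have := @is_derive_line u x j 0; rewrite scale0r addr0; apply.
have dN : is_derive (0 : R) (1 : R) -%R (-1).
  exact: (@is_deriveN _ _ _ id (0 : R) 1 1).
have d2 : is_derive (0 : R) (1 : R) (fun s => u (x - s *: e_ j)) (- partial j u x).
  have := @is_derive1_comp _ (fun s => u (x + s *: e_ j)) -%R 0 (partial j u x) (-1).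
  rewrite mulrN1 oppr0 => /(_ d1 dN).
  congr is_derive; apply/funext => s /=.
  by rewrite scaleNr.
have -> : 2 * partial j u x = partial j u x - - partial j u x by ring.
exact: is_deriveB.
Qed.

Lemma harmonic_partial_bound u (d K : R) j : 0 < d -> 0 < K ->
  (forall x, `|x| <= d -> harmonic_at u x /\ `|u x| <= K) ->
  derivable u 0 (e_ j) -> `|partial j u 0| <= n.+1%:R * K / d.
Proof.
move=> d0 K0 Hu du.
have := is_derive_bound d0 (is_derive_symdiff du).
move=> /(_ (2 * (n.+1%:R * K / d))).
rewrite normrM ger0_norm // ler_pM2l //; apply.
  by rewrite scale0r addr0 subr0 subrr.
move=> s s0 sd; apply: harmonic_symdiff => //; first exact: ltW.
by move=> x; rewrite add0r; exact: Hu.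
Qed.

(** The points [x] and [x + t e_j] are [b - (t/2) e_j] and [b + (t/2) e_j] around
    their midpoint [b], so the difference of their symmetric differences in
    direction [i] is a second difference at [b]. *)
Lemma harmonic_partial_lipschitz u (d K : R) (i j : 'I_n) x (t : R) :
  0 < d -> 0 < K ->
  (forall z, `|z| <= 3 * d -> harmonic_at u z /\ `|u z| <= K) ->
  (forall z, `|z| <= d -> derivable u z (e_ i)) ->
  `|x| <= d -> `|x + t *: e_ j| <= d ->
  `|partial i u (x + t *: e_ j) - partial i u x| <= (n.+1%:R / d) ^+ 2 * K * `|t|.
Proof.
move=> d0 K0 Hu du; wlog t0 : x t / 0 <= t => [wl|xd xtd].
  have [|t0] := leP 0 t; first by move=> t0; apply: wl.
  move=> xd xtd; rewrite distrC.
  have := wl (x + t *: e_ j) (- t).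
  by rewrite scaleNr addrK normrN oppr_ge0; apply=> //; exact: ltW.
pose b := x + (t / 2) *: e_ j; pose t' := t / 2.
have bp : b + t' *: e_ j = x + t *: e_ j.
  by rewrite /b -addrA -scalerDl -splitr.
have bm : b - t' *: e_ j = x by rewrite /b addrK.
have t'0 : 0 <= t' by rewrite /t' divr_ge0.
have bd : `|b| <= d.
  have -> : b = 2^-1 *: (x + (x + t *: e_ j)).
    by apply/rowP => k; rewrite /b !mxE; field.
  rewrite normrZ ger0_norm ?invr_ge0 // mulrC ler_pdivrMr //.
  by rewrite (le_trans (ler_normD _ _)) // mulr_natr mulr2n lerD.
have t'd : t' <= d.
  have := le_trans (rV_coord_le x j) xd; have := le_trans (rV_coord_le _ j) xtd.
  rewrite !mxE !eqxx mulr1 !ler_norml /t' => /andP[? ?] /andP[? ?]; lra.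
have := is_derive_bound d0 (is_deriveB (is_derive_symdiff (du _ xtd))
                                       (is_derive_symdiff (du _ xd))).
move=> /(_ (2 * ((n.+1%:R / d) ^+ 2 * K * `|t|))).
rewrite -mulrBr normrM [`|2|]ger0_norm // ler_pM2l //; apply.
  by rewrite !fctE /= !scale0r !addr0 !subr0 !subrr.
move=> s s0 sd; rewrite !fctE /=.
have := harmonic_second_symdiff i j d0 K0 t'0 t'd (ltW s0) sd bd Hu.
rewrite ![_ + s *: e_ i + _]addrAC ![_ - s *: e_ i + _]addrAC.
rewrite bp bm (ger0_norm t0).
have -> : 2 * ((n.+1%:R / d) ^+ 2 * K * t) * s = (2 * (n.+1%:R / d)) ^+ 2 * K * s * t'.
  by rewrite /t'; field; rewrite gt_eqF.
apply: le_trans; rewrite le_eqVlt; apply/orP; left; apply/eqP; congr `|_|.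
ring.
Qed.

End PartialDerivatives.

(** * From coordinate directions to all directions *)

Section CoordinateSteps.
Context {R : realType} {n : nat}.
Local Notation V := 'rV[R]_n.
Local Notation e_ j := (delta_mx (0 : 'I_1) (j : 'I_n) : V).
Implicit Types (u : V -> R) (x y z : V).

(** Go from [y] to [x] by replacing the coordinates one after the other; the
    intermediate points stay in the cube. *)
Lemma coordwise_lipschitz u (r L : R) : 0 <= r -> 0 <= L ->
  (forall x j t, `|x| <= r -> `|x + t *: e_ j| <= r ->
     `|u (x + t *: e_ j) - u x| <= L * `|t|) ->
  forall x y, `|x| <= r -> `|y| <= r -> `|u x - u y| <= n%:R * L * `|x - y|.
Proof.
move=> r0 L0 HL x y xr yr.
pose z k : V := \row_i (if (i < k)%N then x 0 i else y 0 i).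
have zr k : `|z k| <= r.
  apply/rV_norm_leP => // i; rewrite mxE.
  by case: ifP => _; [exact: le_trans (rV_coord_le x i) xr
                     |exact: le_trans (rV_coord_le y i) yr].
have step k : (k <= n)%N -> `|u (z k) - u y| <= k%:R * L * `|x - y|.
  elim: k => [_|k IH kn].
    have -> : z 0%N = y by apply/rowP => i; rewrite mxE.
    by rewrite subrr normr0 !mul0r.
  have zS : z k.+1 = z k + (x - y) 0 (Ordinal kn) *: e_ (Ordinal kn).
    apply/rowP => i; rewrite !mxE /= ltnS leq_eqVlt -val_eqE /=.
    by case: (ltngtP i k) => ik /=; rewrite ?mulr0 ?addr0 // (_ : i = Ordinal kn);
      [ring|apply: val_inj].
  rewrite -[u (z k.+1)](subrK (u (z k))) -addrA (le_trans (ler_normD _ _)) //.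
  have -> : k.+1%:R * L * `|x - y| = L * `|x - y| + k%:R * L * `|x - y|.
    by rewrite -natr1; ring.
  apply: lerD; last by apply: IH; exact: ltnW.
  rewrite {1}zS (le_trans (HL _ _ _ (zr k) _)) -?zS //.
  by rewrite ler_wpM2l // rV_coord_le.
have -> : x = z n by apply/rowP => i; rewrite mxE ltn_ord.
have {2}-> : z n = x by apply/rowP => i; rewrite mxE ltn_ord.
exact: step.
Qed.

(** The mean value theorem along coordinate segments, applied to [u] minus the
    linear form with coefficients [a]. *)
Lemma strict_differential_bound u (a : 'I_n -> R) (r e : R) : 0 <= r -> 0 <= e ->
  (forall z j, `|z| <= r ->
     derivable u z (e_ j) /\ `|partial j u z - a j| <= e) ->
  forall x y, `|x| <= r -> `|y| <= r ->
  `|u x - u y - \sum_j a j * (x 0 j - y 0 j)| <= n%:R * e * `|x - y|.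
Proof.
move=> r0 e0 Hu x y xr yr.
pose G x := u x - \sum_j a j * x 0 j.
have -> : u x - u y - \sum_j a j * (x 0 j - y 0 j) = G x - G y.
  rewrite /G; under eq_bigr do rewrite mulrBr.
  by rewrite sumrB; ring.
apply: (coordwise_lipschitz r0 e0 _ xr yr) => {x y xr yr} x j t.
wlog t0 : x t / 0 <= t => [wl|xr xtr].
  have [|t0] := leP 0 t; first by move=> t0; apply: wl.
  move=> xr xtr; rewrite distrC.
  have := wl (x + t *: e_ j) (- t).
  by rewrite scaleNr addrK normrN oppr_ge0; apply=> //; exact: ltW.
have seg s : 0 <= s -> s <= t -> `|x + s *: e_ j| <= r.
  move=> s0 st; apply/rV_norm_leP => // l.
  have := le_trans (rV_coord_le x l) xr; have := le_trans (rV_coord_le _ l) xtr.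
  rewrite !mxE /= !ler_norml; case: (l == j); rewrite /= ?mulr0 ?addr0 // !mulr1.
  by move=> /andP[? ?] /andP[? ?]; apply/andP; split; lra.
have GE s : G (x + s *: e_ j) = (u (x + s *: e_ j) - a j * s) - \sum_j a j * x 0 j.
  rewrite /G; have -> : \sum_l a l * (x + s *: e_ j) 0 l =
      \sum_l a l * x 0 l + a j * s.
    rewrite (bigD1 j) //= [in RHS](bigD1 j) //= !mxE !eqxx /=.
    rewrite (eq_bigr (fun l => a l * x 0 l)); first by ring.
    by move=> l lj; rewrite !mxE (negbTE lj) andbF mulr0 addr0.
  ring.
have dF s : 0 <= s -> s <= t -> is_derive s (1 : R)
    (fun s => u (x + s *: e_ j) - a j * s) (partial j u (x + s *: e_ j) - a j).
  move=> s0 st; have [du _] := Hu _ j (seg _ s0 st).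
  have d1 := is_derive_line du.
  have d2 : is_derive s (1 : R) (fun s => a j * s) (a j).
    by apply: is_derive_eq; rewrite /GRing.scale /=; ring.
  exact: is_deriveB.
have [] := @MVT_segment _ (fun s => u (x + s *: e_ j) - a j * s)
    (fun s => partial j u (x + s *: e_ j) - a j) 0 t t0.
- by move=> s; rewrite in_itv/= => /andP[s0 st]; apply: dF; exact: ltW.
- apply: derivable_within_continuous => s; rewrite in_itv/= => /andP[s0 st].
  by have [] := dF s s0 st.
move=> c; rewrite in_itv/= => /andP[c0 ct] eqG.
have -> : G (x + t *: e_ j) - G x = (partial j u (x + c *: e_ j) - a j) * t.
  have := GE 0; rewrite scale0r addr0 => ->; rewrite GE.
  by move: eqG; rewrite scale0r addr0 subr0 => <-; ring.
by rewrite normrM ler_wpM2r // (Hu _ j (seg _ c0 ct)).2.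
Qed.

End CoordinateSteps.

(** * Quantitative inverse function theorem *)

Section Adjugate.
Context {R : realType}.

Lemma det_norm_le n (A : 'M[R]_n) (b : R) :
  (forall i j, `|A i j| <= b) -> `|\det A| <= n`!%:R * b ^+ n.
Proof.
move=> Ab; rewrite (le_trans (ler_norm_sum _ _ _)) //.
rewrite (le_trans (_ : _ <= \sum_(s : 'S_n) b ^+ n)) //.
  apply: ler_sum => s _; rewrite normrM normrX normrN normr1 expr1n mul1r.
  rewrite normr_prod -[X in b ^+ X]card_ord -prodr_const.
  by apply: ler_prod => i _; rewrite normr_ge0 Ab.
by rewrite sumr_const card_Sn mulr_natl.
Qed.

Lemma mul_adj_norm_le n (A : 'M[R]_n) (b : R) (w : 'rV[R]_n) :
  (forall i j, `|A i j| <= b) ->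
  `|w *m (\adj A)^T| <= n%:R * (n.-1`!%:R * b ^+ n.-1) * `|w|.
Proof.
move=> Ab.
have cof i j : `|(\adj A) i j| <= n.-1`!%:R * b ^+ n.-1.
  rewrite mxE normrM normrX normrN normr1 expr1n mul1r.
  by apply: det_norm_le => k l; rewrite !mxE.
have c0 : n%:R * (n.-1`!%:R * b ^+ n.-1) * `|w| >= 0.
  case: n A w Ab cof => [|n] A w Ab cof; first by rewrite !mul0r.
  by rewrite !mulr_ge0 // exprn_ge0 // (le_trans _ (Ab 0 0)).
apply/rV_norm_leP => // i; rewrite mxE (le_trans (ler_norm_sum _ _ _)) //.
rewrite (le_trans (_ : _ <= \sum_(j < n) (n.-1`!%:R * b ^+ n.-1) * `|w|)) //.
  apply: ler_sum => j _; rewrite mxE normrM mulrC.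
  by apply: ler_pM; rewrite ?normr_ge0 ?cof ?rV_coord_le.
by rewrite sumr_const card_ord -[leLHS]mulr_natl [leLHS]mulrA.
Qed.

End Adjugate.

(* Joins the complete and normed structures of row vectors, as the contraction
   principle requires. *)
HB.instance Definition _ (R : realType) n := Complete.on 'rV[R]_n.

Section InverseFunction.
Context {R : realType} {n : nat}.
Implicit Types (x y : 'rV[R]_n).

Lemma closed_cube (r : R) : closed [set x : 'rV[R]_n | `|x| <= r].
Proof.
apply: (@closed_comp _ _ (fun x : 'rV[R]_n => `|x|) [set t | t <= r]).
  by move=> x _; exact: norm_continuous.
exact: closed_le.
Qed.

(** Newton iteration with the derivative held constant at [A]: the map
    [x |-> x - (f x - y) A^-1] contracts the cube of radius [r] by the factor
    [1/2], and its fixed point is a preimage of [y]. Vectors are rows, so [A]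
    and [A^-1 = \adj A] act on the right through their transposes. *)
Lemma linear_perturbation_onto (f : 'rV[R]_n -> 'rV[R]_n) (A : 'M[R]_n)
    (r b e : R) :
  \det A = 1 -> f 0 = 0 -> 0 < r -> 0 < b -> 0 <= e ->
  (forall w : 'rV[R]_n, `|w *m (\adj A)^T| <= b * `|w|) -> b * e <= 2^-1 ->
  (forall x y k, `|x| <= r -> `|y| <= r ->
     `|f x 0 k - f y 0 k - \sum_j A k j * (x 0 j - y 0 j)| <= e * `|x - y|) ->
  forall y, `|y| <= r / (2 * b) -> exists2 x, `|x| <= r & f x = y.
Proof.
move=> detA f0 r0 b0 e0 Hb be Hf y yr.
have r_ge0 := ltW r0.
pose P := (\adj A)^T.
have AP : A^T *m P = 1%:M by rewrite -trmx_mul mul_adj_mx detA trmx1.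
have PA : P *m A^T = 1%:M by rewrite -trmx_mul mul_mx_adj detA trmx1.
pose T x := x - (f x - y) *m P.
have Tlip x x' : `|x| <= r -> `|x'| <= r -> `|T x - T x'| <= 2^-1 * `|x - x'|.
  move=> xr x'r.
  have -> : T x - T x' = - ((f x - f x' - (x - x') *m A^T) *m P).
    rewrite mulmxBl -mulmxA AP mulmx1 /T mulmxBl [(f x - f x') *m P]mulmxBl mulmxBl.
    by apply/rowP => i; move: (f x *m P) (f x' *m P) (y *m P) => p q s; rewrite !mxE; ring.
  rewrite normrN (le_trans (Hb _)) //.
  rewrite (le_trans (_ : _ <= b * e * `|x - x'|)) //; last by rewrite ler_wpM2r.
  rewrite -mulrA ler_pM2l //; apply/rV_norm_leP => [|k]; first exact: mulr_ge0.
  have := Hf x x' k xr x'r; rewrite !mxE.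
  by under [in X in _ -> `|_ - X| <= _]eq_bigr do rewrite !mxE mulrC.
have T0 : `|T 0| <= r / 2.
  rewrite /T f0 !sub0r mulNmx opprK (le_trans (Hb _)) //.
  rewrite (le_trans (ler_wpM2l (ltW b0) yr)) // le_eqVlt; apply/orP; left.
  by apply/eqP; field; rewrite gt_eqF.
pose U : set 'rV[R]_n := [set x | `|x| <= r].
have TU : {homo T : x / U x >-> U x}.
  move=> x xr; rewrite /U /= -[T x](subrK (T 0)) (le_trans (ler_normD _ _)) //.
  have := Tlip x 0 xr; rewrite normr0 subr0 => /(_ r_ge0) h.
  have : `|x| <= r by [].
  lra.
have half0 : 0 <= 2^-1 :> R by rewrite invr_ge0.
have ctr : is_contraction (mkfun_fun TU).
  exists (NngNum half0); split => /=; first by lra.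
  by move=> [x x'] [/= xr x'r]; exact: Tlip.
have [|p pr pT] := banach_fixed_point ctr (@closed_cube r).
  by exists 0; rewrite /U /= normr0.
exists p => //; apply/eqP; rewrite -subr_eq0; apply/eqP.
rewrite -[LHS]mulmx1 -PA mulmxA.
have -> : (f p - y) *m P = p - T p by rewrite /T subKr.
by rewrite {1}pT subrr mul0mx.
Qed.

End InverseFunction.

(** * Uniform estimates over the class *)

(** A cube of this radius, enlarged three times, still lies in the Euclidean unit
    ball; the enlargement is what the two difference steps consume. *)
Definition cube_radius (R : realType) (n : nat) : R := n.+1%:R^-1 / 4.

Lemma cube_radius_gt0 (R : realType) n : 0 < cube_radius R n.
Proof. by rewrite divr_gt0 // invr_gt0. Qed.

Lemma cube_radius_lt (R : realType) n : 3 * cube_radius R n < n.+1%:R^-1.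
Proof.
have : 0 < n.+1%:R^-1 :> R by rewrite invr_gt0.
by rewrite /cube_radius; move: (n.+1%:R^-1) => q; lra.
Qed.

Section Ball.
Context {R : realType} {n : nat}.
Implicit Types (x : 'rV[R]_n).

Lemma enorm_coord_le x i : `|x 0 i| <= enorm x.
Proof.
rewrite -sqrtr_sqr ler_wsqrtr // (bigD1 i) //= lerDl.
by apply: sumr_ge0 => j _; exact: sqr_ge0.
Qed.

Lemma norm_le_enorm x : `|x| <= enorm x.
Proof. by apply/rV_norm_leP => [|i]; [exact: sqrtr_ge0|exact: enorm_coord_le]. Qed.

Lemma cube_sub_eball x : `|x| <= n.+1%:R^-1 -> eball 1 x.
Proof.
move=> xn; rewrite /eball /= -[ltRHS]sqrtr1 ltr_sqrt //.
rewrite (le_lt_trans (_ : _ <= \sum_(i < n) (n.+1%:R^-1) ^+ 2)) //.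
  apply: ler_sum => i _; rewrite -real_normK ?num_real //.
  by rewrite lerXn2r ?nnegrE // ?invr_ge0 // (le_trans (rV_coord_le _ _)).
rewrite sumr_const card_ord -[ltLHS]mulr_natl expr2 mulrA.
have h : n%:R * n.+1%:R^-1 < 1 :> R by rewrite ltr_pdivrMr // mul1r ltr_nat.
apply: le_lt_trans h; rewrite ler_piMr ?mulr_ge0 ?invr_ge0 //.
by rewrite invf_le1 // ler1n.
Qed.

Lemma small_cube_sub_eball x : `|x| <= cube_radius R n -> eball 1 x.
Proof.
move=> xd; apply: cube_sub_eball; rewrite (le_trans xd) //.
by move: (cube_radius_gt0 R n) (cube_radius_lt R n); move: (n.+1%:R^-1) => q; lra.
Qed.

Lemma FclassM_bound g M (f : 'rV[R]_n -> 'rV[R]_n) x : FclassM g M f -> eball 1 x ->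
  enorm (f x) <= M.
Proof.
move=> [_ fgM] x1; rewrite -lee_fin; apply: le_trans fgM.
apply: (@le_trans _ _ (supnorm f)); first by apply: ereal_sup_ubound; exists x.
apply: leeDl.
apply: (@le_trans _ _ (enorm (g x))%:E); first by rewrite lee_fin sqrtr_ge0.
by apply: ereal_sup_ubound; exists x.
Qed.

Lemma C2_on_sub (A B : set 'rV[R]_n) u : A `<=` B -> C2_on B u -> C2_on A u.
Proof.
by move=> AB [C1 C2]; split=> [j x /AB|i j x /AB]; [exact: C1|exact: C2].
Qed.

End Ball.

Section Difference.
Context {R : realType} {n : nat}.
Local Notation V := 'rV[R]_n.
Local Notation e_ j := (delta_mx (0 : 'I_1) (j : 'I_n) : V).
Variables (g : V -> V) (M : R).
Implicit Types (f : V -> V) (x z : V).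

Local Notation d := (cube_radius R n).

Lemma Fclass_derivable f k j x : Fclass g f -> eball 1 x ->
  derivable (component f k) x (e_ j).
Proof. by move=> [_ /(_ k)[C1 _] _ _ _] x1; apply: (C1 j x x1).1. Qed.

(** Both maps solve the same Poisson equation. *)
Lemma FclassM_diff_harmonic f f0 k z : 0 < M -> FclassM g M f -> FclassM g M f0 ->
  `|z| <= 3 * d ->
  harmonic_at (fun x => component f k x - component f0 k x) z /\
  `|component f k z - component f0 k z| <= 2 * M.
Proof.
move=> M0 fM f0M zr.
have zU : ball (0 : V) n.+1%:R^-1 z.
  rewrite -ball_normE /= sub0r normrN; exact: le_lt_trans zr (cube_radius_lt R n).
have sub : ball (0 : V) n.+1%:R^-1 `<=` eball 1.
  move=> x; rewrite -ball_normE /= sub0r normrN => /ltW; exact: cube_sub_eball.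
have cont f' : Fclass g f' -> {for z, continuous (component f' k)}.
  move=> [cf _ _ _ _].
  have : {within ball (0 : V) n.+1%:R^-1, continuous f'}.
    by apply: continuous_subspaceW cf => x /sub; rewrite /eball /ecball /= => /ltW.
  rewrite continuous_open_subspace; last exact: ball_open.
  move=> /(_ z); rewrite inE => /(_ zU) cz.
  have -> : component f' k = (fun y : V => y 0 k) \o f' by [].
  by apply: continuous_comp cz _; exact: coord_continuous.
split.
  apply: (@harmonic_at_sub _ _ (ball (0 : V) n.+1%:R^-1)) => //.
  - exact: ball_open.
  - by case: fM => -[_ H _ _ _] _; exact: C2_on_sub (H k).
  - by case: f0M => -[_ H _ _ _] _; exact: C2_on_sub (H k).
  - exact: cont fM.1.
  - exact: cont f0M.1.
  case: fM => -[_ _ /(_ z (sub _ zU)) E _ _] _.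
  case: f0M => -[_ _ /(_ z (sub _ zU)) E0 _ _] _.
  by have := congr1 (fun v : V => v 0 k) (etrans E (esym E0)); rewrite !mxE.
have := FclassM_bound fM (sub _ zU); have := FclassM_bound f0M (sub _ zU).
move=> /(le_trans (enorm_coord_le _ k)) h0 /(le_trans (enorm_coord_le _ k)) h1.
have -> : 2 * M = M + M by ring.
by rewrite (le_trans (ler_normB _ _)) // lerD.
Qed.

(** The modulus of continuity on the right depends on [f0], [M] and [n] but not on
    [f]. *)
Lemma FclassM_partial_modulus f f0 k i z : 0 < M -> FclassM g M f -> FclassM g M f0 ->
  `|z| <= d ->
  `|partial i (component f k) z - partial i (component f k) 0| <=
  `|partial i (component f0 k) z - partial i (component f0 k) 0| +
    n%:R * ((n.+1%:R / d) ^+ 2 * (2 * M)) * `|z|.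
Proof.
move=> M0 fM f0M zr.
have d0 := cube_radius_gt0 R n.
have K0 : 0 < 2 * M by rewrite mulr_gt0.
have df f' y : FclassM g M f' -> `|y| <= d ->
    derivable (component f' k) y (e_ i).
  by move=> [F' _] yr; exact: Fclass_derivable F' (small_cube_sub_eball yr).
pose h := (fun x => component f k x - component f0 k x).
have dh y : `|y| <= d -> partial i h y =
    partial i (component f k) y - partial i (component f0 k) y.
  by move=> yr; apply: deriveB; exact: df.
have z0 : `|0 : V| <= d by rewrite normr0 ltW.
have : `|partial i h z - partial i h 0| <=
    n%:R * ((n.+1%:R / d) ^+ 2 * (2 * M)) * `|z - 0|.
  apply: (coordwise_lipschitz (ltW d0) _ _ zr z0).
    by rewrite mulr_ge0 ?sqr_ge0 // ltW.
  move=> x j t xr xtr; apply: harmonic_partial_lipschitz => //.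
    by move=> y; exact: FclassM_diff_harmonic.
  by move=> y yr; apply: derivableB; exact: df.
rewrite subr0 !dh //.
set a := partial i _ z; set b := partial i _ z; set c := partial i _ 0; set e := partial i _ 0.
move=> H; have -> : a - c = (b - e) + (a - b - (c - e)) by ring.
by rewrite (le_trans (ler_normD _ _)) // lerD2l.
Qed.

Lemma FclassM_partial0_bound f f0 k i : 0 < M -> FclassM g M f -> FclassM g M f0 ->
  `|partial i (component f k) 0| <=
  `|partial i (component f0 k) 0| + n.+1%:R * (2 * M) / d.
Proof.
move=> M0 fM f0M.
have d0 := cube_radius_gt0 R n.
have K0 : 0 < 2 * M by rewrite mulr_gt0.
have in1 : @eball R n 1 0 by apply: cube_sub_eball; rewrite normr0 invr_ge0.
have df f' : FclassM g M f' -> derivable (component f' k) 0 (e_ i).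
  by move=> [F' _]; exact: Fclass_derivable.
pose h := (fun x => component f k x - component f0 k x).
have dh : partial i h 0 = partial i (component f k) 0 - partial i (component f0 k) 0.
  by apply: deriveB; exact: df.
have : `|partial i h 0| <= n.+1%:R * (2 * M) / d.
  apply: harmonic_partial_bound => //; last by apply: derivableB; exact: df.
  move=> x xr; apply: FclassM_diff_harmonic => //.
  by rewrite (le_trans xr) //; lra.
rewrite dh; set a := partial i _ 0; set b := partial i _ 0 => H.
have -> : a = b + (a - b) by ring.
by rewrite (le_trans (ler_normD _ _)) // lerD2l.
Qed.

End Difference.

Lemma partials_near0 (R : realType) (n : nat) (g f0 : 'rV[R]_n -> 'rV[R]_n) (e : R) :
  Fclass g f0 -> 0 < e -> exists2 r : R, 0 < r & forall z, `|z| <= r -> forall k i,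
  `|partial i (component f0 k) z - partial i (component f0 k) 0| <= e.
Proof.
move=> [_ C2 _ _ _] e0.
have in1 : @eball R n 1 0 by apply: cube_sub_eball; rewrite normr0 invr_ge0.
pose P (ki : 'I_n * 'I_n) (z : 'rV[R]_n) : Prop :=
  `|partial ki.2 (component f0 ki.1) z - partial ki.2 (component f0 ki.1) 0| <= e.
have : \forall z \near (0 : 'rV[R]_n), forall ki, P ki z.
  apply: (@filter_forall _ _ P _ (nbhs_filter _)) => -[k i].
  have [C1 _] := C2 k; have [_ cp] := C1 i 0 in1.
  by have /cvgrPdist_le/(_ e e0) := cp; apply: filterS => z; rewrite /P /= distrC.
move=> /nbhs_ballP[r /= r0 Hr]; exists (r / 2); first by rewrite divr_gt0.
move=> z zr k i; apply: (Hr z _ (k, i)).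
by rewrite -ball_normE /= sub0r normrN (le_lt_trans zr) // ltr_pdivrMr // ltr_pMr // ltr1n.
Qed.

Theorem theorem4 (R : realType) (n : nat) (hn : (3 <= n)%N)
  (g : 'rV[R]_n -> 'rV[R]_n) (hg : {within ecball 1, continuous g})
  (M : R) (hM : 0 < M) :
  exists r0 : R, 0 < r0 /\
    forall f : 'rV[R]_n -> 'rV[R]_n, FclassM g M f ->
      eball r0 `<=` f @` eball 1.
Proof.
(* The reference map of the class; every constant below is built from it. *)
have [[f0 f0M]|noF] := pselect (exists f0, FclassM g M f0); last first.
  by exists 1; split=> // f fM; case: noF; exists f.
pose d := cube_radius R n.
have d0 : 0 < d := cube_radius_gt0 R n.
(* [b] bounds the Jacobian entries at [0], [c] the inverse matrix, and [e] is chosen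
   so that [c * (n * (2 * e)) = 1/2]. *)
pose b : R := 1 + \sum_(ki : 'I_n * 'I_n) `|partial ki.2 (component f0 ki.1) 0|
  + n.+1%:R * (2 * M) / d.
have bP k i : `|partial i (component f0 k) 0| + n.+1%:R * (2 * M) / d <= b.
  rewrite lerD2r (bigD1 (k, i)) //= addrCA lerDl addr_ge0 //.
  by apply: sumr_ge0 => *; exact: normr_ge0.
have b1 : 1 <= b.
  rewrite /b -addrA lerDl addr_ge0 //; first by apply: sumr_ge0 => *; exact: normr_ge0.
  by rewrite !mulr_ge0 // ?invr_ge0 ltW.
have n0 : 0 < n%:R :> R by rewrite ltr0n (leq_trans _ hn).
pose c : R := n%:R * (n.-1`!%:R * b ^+ n.-1).
have c0 : 0 < c.
  rewrite !mulr_gt0 // ?ltr0n ?fact_gt0 //.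
  by apply: exprn_gt0; exact: lt_le_trans ltr01 b1.
pose e : R := (4 * n%:R * c)^-1.
have e0 : 0 < e by rewrite invr_gt0 mulr_gt0 // mulr_gt0.
pose L : R := n%:R * ((n.+1%:R / d) ^+ 2 * (2 * M)).
have L0 : 0 <= L by rewrite mulr_ge0 // mulr_ge0 ?sqr_ge0 // mulr_ge0 // ltW.
have [r1 r10 Hr1] := partials_near0 f0M.1 e0.
(* Half of the admissible error [2 * e] goes to [f0] and half to the harmonic part. *)
pose r := Num.min d (Num.min r1 (e / (L + 1))).
have L1 : 0 < L + 1 by lra.
have r0 : 0 < r by rewrite !lt_min d0 r10 divr_gt0.
have rd : r <= d by rewrite ge_min lexx.
have rr1 : r <= r1 by rewrite !ge_min lexx orbT.
have re : L * r <= e.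
  have : r <= e / (L + 1) by rewrite !ge_min lexx !orbT.
  by rewrite ler_pdivlMr //; lra.
exists (r / (2 * c)); split; first by rewrite divr_gt0 // mulr_gt0.
move=> f fM y yr.
have Ab k i : `|jacobian_mx f 0 k i| <= b.
  by rewrite mxE; exact: le_trans (FclassM_partial0_bound k i hM fM f0M) (bP k i).
have [x xr fx] : exists2 x, `|x| <= r & f x = y.
  apply: (@linear_perturbation_onto R n f (jacobian_mx f 0) r c (n%:R * (2 * e))) => //.
  - by case: fM => -[].
  - by case: fM => -[].
  - by rewrite !mulr_ge0 // ltW.
  - by move=> w; exact: mul_adj_norm_le.
  - rewrite le_eqVlt; apply/orP; left; apply/eqP; rewrite /e; field.
    by rewrite !gt_eqF.
  - move=> x x' k xr x'r.
    under eq_bigr do rewrite mxE.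
    apply: (@strict_differential_bound _ _ (component f k)
      (fun j => partial j (component f k) 0) r) => //.
    + exact: ltW.
    + by rewrite mulr_ge0 // ltW.
    move=> z j zr; split.
      apply: Fclass_derivable fM.1 _.
      by apply: small_cube_sub_eball; exact: le_trans zr rd.
    rewrite (le_trans (FclassM_partial_modulus k j hM fM f0M (le_trans zr rd))) //.
    have -> : 2 * e = e + e by ring.
    rewrite lerD ?Hr1 ?(le_trans zr) //.
    by apply: le_trans re; rewrite ler_wpM2l.
  - by apply: le_trans (norm_le_enorm y) (ltW yr).
exists x => //; apply: small_cube_sub_eball; exact: le_trans xr rd.
Qed.
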